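(* Let $d\ge 2$ and $r\in\mathbb{N}\setminus\{1,2,4\}$. The space $\mathcal{M}^{\sigma}_{X_r}$ of shift-invariant Markov cocycles on $X_r$ has a linear basis $\{M_0,M_1,\ldots,M_{r-1}\}$, where $$M_i(x,y):=\sum_{n\in\mathbb{Z}^d}N_i(\hat x_n,\hat y_n),\qquad (x,y)\in\Delta_{X_r},$$ and $(\hat x,\hat y)\in\Delta_{Ht}$ is any pair which is mapped to $(x,y)$ by $\phi_r$. In particular $\dim(\mathcal{M}^{\sigma}_{X_r})=r$.
   Context: $\mathbb{Z}^d$ is regarded as the vertex set of the graph in which $n,m$ are adjacent iff $\|n-m\|_1=1$. For $F\subset\mathbb{Z}^d$, $\partial F$ is the set of sites outside $F$ adjacent to some site of $F$. The shift action is $(\sigma_n x)_m=x_{m+n}$. $Ht=\{\hat x\in\mathbb{Z}^{\mathbb{Z}^d}: |\hat x_n-\hat x_m|=1 \text{ whenever } \|n-m\|_1=1\}$; $\phi_r:Ht\to(\mathbb{Z}_r)^{\mathbb{Z}^d}$, $\mathbb{Z}_r=\mathbb{Z}/r\mathbb{Z}$, is coordinatewise reduction modulo $r$; and $X_r=\phi_r(Ht)$. For $X=X_r$ or $X=Ht$, $\Delta_X$ is the set of pairs $(x,y)\in X\times X$ with $x_n=y_n$ for all but finitely many $n$. Every $(x,y)\in\Delta_{X_r}$ is the image of some $(\hat x,\hat y)\in\Delta_{Ht}$ under $\phi_r$ (applied to both coordinates), the differences $\hat x_n-\hat y_n$ are even, and any two such lifts of $(x,y)$ differ by adding a common integer multiple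 of $r$ to all coordinates of both functions. For $i\in\mathbb{Z}_r$ and integers $a,b$ with $a-b$ even, $N_i(a,b)=|\{m\in(2\mathbb{Z}+a)\cap(r\mathbb{Z}+i): m\in[a,b)\}|$ if $a\le b$, and $N_i(a,b)=-N_i(b,a)$ otherwise. A $\Delta_X$-cocycle is a function $M:\Delta_X\to\mathbb{R}$ with $M(x,z)=M(x,y)+M(y,z)$ whenever $(x,y),(y,z)\in\Delta_X$. It is a Markov cocycle if, for every finite $F$ and all $(x,y)\in\Delta_X$ with $x|_{F^c}=y|_{F^c}$, the value $M(x,y)$ is determined by $x|_{F\cup\partial F}$ and $y|_{F\cup\partial F}$. It is shift-invariant if $M(\sigma_n x,\sigma_n y)=M(x,y)$ for all $n\in\mathbb{Z}^d$. $\mathcal{M}^\sigma_X$ is the real vector space of shift-invariant Markov cocycles on $X$. *)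

(* Defs.v *)
From mathcomp Require Import all_boot all_order all_algebra.
From mathcomp Require Import finmap.
From mathcomp Require Import all_classical all_reals.

Set Implicit Arguments.
Unset Strict Implicit.
Unset Printing Implicit Defensive.

Import Order.TTheory GRing.Theory Num.Theory.
Local Open Scope classical_set_scope.
Local Open Scope ring_scope.

Definition site (d : nat) := 'rV[int]_d.

Definition adjacent (d : nat) (n m : site d) : Prop :=
  \sum_(k < d) `|n 0 k - m 0 k| = 1.

Definition boundary (d : nat) (F : set (site d)) : set (site d) :=
  [set n | ~ F n /\ exists2 m, F m & adjacent n m].

Definition shift (d : nat) (A : Type) (n : site d) (x : site d -> A) :
  site d -> A := fun m => x (m + n).

Definition Ht (d : nat) : set (site d -> int) :=
  [set x | forall n m, adjacent n m -> `|x n - x m| = 1].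

(* 'Z_r is Z/rZ only for r >= 2, which holds wherever it is used. *)
Definition phi (d r : nat) (x : site d -> int) : site d -> 'Z_r :=
  fun n => (x n)%:~R.

Definition X (d r : nat) : set (site d -> 'Z_r) := @phi d r @` @Ht d.

Definition Delta (d : nat) (A : Type) (X : set (site d -> A)) :
    set ((site d -> A) * (site d -> A)) :=
  [set p | [/\ X p.1, X p.2 & finite_set [set n | p.1 n <> p.2 n]]].

(* Functions on Delta_X are functions on the subtype attached to the set
   [Delta X]; R^o makes them a real vector space under pointwise operations. *)
Definition Delta_fun (R : realType) (d : nat) (A : Type)
    (X : set (site d -> A)) : lmodType R := (Delta X -> R^o).

Section Cocycles.
Variables (R : realType) (d : nat) (A : Type) (X : set (site d -> A)).
Implicit Types (M : Delta_fun R X) (p q s : Delta X).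

Definition cocycle M : Prop := forall p q s,
  (val p).2 = (val q).1 -> val s = ((val p).1, (val q).2) -> M s = M p + M q.

Definition markov M : Prop := forall F : set (site d), finite_set F ->
  forall p q,
    {in ~` F, (val p).1 =1 (val p).2} ->
    {in ~` F, (val q).1 =1 (val q).2} ->
    {in F `|` boundary F, (val p).1 =1 (val q).1} ->
    {in F `|` boundary F, (val p).2 =1 (val q).2} ->
  M p = M q.

Definition shift_invariant M : Prop := forall (n : site d) p q,
  val q = (shift n (val p).1, shift n (val p).2) -> M q = M p.

Definition shift_invariant_markov_cocycles : set (Delta_fun R X) :=
  [set M | [/\ cocycle M, markov M & shift_invariant M]].

End Cocycles.

(* The spaces considered need not be finite-dimensional a priori, so they are
   subsets of an lmodType rather than subspaces of a vectType. The equivalence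
   says that S is exactly the linear span of b. *)
Definition is_basis (R : realType) (V : lmodType R) (I : finType)
    (S : set V) (b : I -> V) : Prop :=
  (forall v, S v <-> exists c : I -> R, v = \sum_i c i *: b i) /\
  (forall c : I -> R, \sum_i c i *: b i = 0 -> forall i, c i = 0).

Definition has_dim (R : realType) (V : lmodType R) (S : set V) (n : nat) :
  Prop := exists b : 'I_n -> V, is_basis S b.

Definition N_up (r : nat) (i : 'Z_r) (a b : int) : nat :=
  #|` fset_set [set m : int |
        [/\ (m = a %[mod 2])%Z, m%:~R = i & a <= m < b]] |.

Definition N (r : nat) (i : 'Z_r) (a b : int) : int :=
  if a <= b then (N_up i a b)%:Z else - (N_up i b a)%:Z.

Definition is_lift (d r : nat) (p : Delta (@X d r)) (q : Delta (@Ht d)) :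
    Prop :=
  phi r (val q).1 = (val p).1 /\ phi r (val q).2 = (val p).2.

(* The sum has finite support since N i a a = 0. *)
Definition lift_sum (R : realType) (d r : nat) (i : 'Z_r)
    (q : Delta (@Ht d)) : R :=
  \sum_(n \in [set: site d]) ((N i ((val q).1 n) ((val q).2 n))%:~R : R).

(* The common value of [lift_sum] over all lifts of p. The default 0 is never
   used: for d >= 2 and r > 2 every p has a lift. *)
Definition Mi (R : realType) (d r : nat) (i : 'Z_r) :
    Delta_fun R (@X d r) :=
  fun p => xget 0 [set v : R | exists2 q, is_lift p q & v = lift_sum R i q].

(* Main.v *)
Require Import Defs.
From mathcomp Require Import all_boot all_order all_algebra.
From mathcomp Require Import finmap zify.
From mathcomp Require Import all_classical all_reals.
Import Order.TTheory GRing.Theory Num.Theory.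
Local Open Scope classical_set_scope.
Local Open Scope ring_scope.

(** Why the theorem holds. For [r > 2], the residues of 1 and -1 modulo [r]
    differ, so a point of [X_r] determines the gradient of a height function
    above it along every edge ([phi_gradient]). As the lattice is connected,
    its lift is unique up to an additive constant ([lift_unique]). Two lifts of
    an asymptotic pair differ by a constant near infinity, because for [d >= 2]
    the complement of a box is connected; subtracting that constant gives an
    asymptotic pair of lifts ([lift_exists]).

    The signed count [N i a b] is governed by one recursion, [N_step], from
    which it is additive, invariant under translation by multiples of [r]
    ([N_translate]) and insensitive to where a full period starts
    ([N_period]). The first property makes [M_i] a cocycle and the second makes
    it well defined. The Markov property needs the third as well: two
    pairs that agree on the closure of [F] have the same height difference at
    every site, but this difference may be a nonzero multiple of [r] on the
    holes enclosed by [F] ([Mi_markov]).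

    Conversely, any two asymptotic height functions are joined by finitely many
    moves that raise one site by 2 at a local minimum, or undo such a raise
    ([cocycle_eq0_of_flips]). By the Markov property and shift-invariance, the
    value of a cocycle on such a move depends only on the residue of the height
    at the moved site ([flip_value]); so a cocycle in the space is determined
    by its [r] values on the standard moves [bump i]. Since [M_i] takes the
    value 1 on [bump i] and 0 on the others ([Mi_bump]), the [M_i] form the
    basis dual to these evaluations. *)

(** * Connectivity of the lattice *)

Lemma adjacent_unit {d : nat} (n : site d) (k : 'I_d) :
  adjacent (n + 'e_k) n.
Proof.
rewrite /adjacent (bigD1 k) //= big1 ?addr0 => [|j jk].
  by rewrite !mxE !eqxx addrAC subrr add0r normr1.
by rewrite !mxE (negbTE jk) /= addr0 subrr normr0.
Qed.

Lemma adjacentC {d : nat} (n m : site d) : adjacent n m -> adjacent m n.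
Proof.
by rewrite /adjacent => <-; apply: eq_bigr => k _; rewrite distrC.
Qed.

Lemma adjacent_neq {d : nat} (n m : site d) : adjacent n m -> n <> m.
Proof.
by move=> + nm; rewrite nm /adjacent big1 // => k _; rewrite subrr normr0.
Qed.

Lemma adjacentDr {d : nat} (v n m : site d) :
  adjacent n m -> adjacent (n + v) (m + v).
Proof.
rewrite /adjacent => <-; apply: eq_bigr => k _; rewrite !mxE; congr `|_|.
by rewrite opprD addrACA subrr addr0.
Qed.

Lemma constant_on_line {d : nat} {T : Type} (A : set (site d))
    (g : site d -> T) (k : 'I_d) (n : site d) (z : int) :
  (forall n m, A n -> A m -> adjacent n m -> g n = g m) ->
  (forall n z, A n -> A (n + z *: 'e_k)) -> A n -> g (n + z *: 'e_k) = g n.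
Proof.
move=> gA Ak An.
have step y : g (n + (y + 1) *: 'e_k) = g (n + y *: 'e_k).
  apply: gA; [exact: Ak|exact: Ak|].
  by rewrite scalerDl scale1r addrA; exact: adjacent_unit.
elim: z => [|z IH|z IH]; first by rewrite scale0r addr0.
  by rewrite (_ : Posz z.+1 = z%:Z + 1) ?step //; lia.
by rewrite -IH -[LHS]step; congr (g (n + _ *: _)); lia.
Qed.

(** The displacement [w] is decomposed into its components along the axes; the
    stability of [A] along these axes keeps the broken line inside [A]. *)
Lemma constant_along {d : nat} {T : Type} (A : set (site d))
    (g : site d -> T) (n w : site d) :
  (forall n m, A n -> A m -> adjacent n m -> g n = g m) ->
  (forall k, w 0 k != 0 -> forall n z, A n -> A (n + z *: 'e_k)) ->
  A n -> g (n + w) = g n.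
Proof.
move=> gA wA An; rewrite (row_sum_delta w).
suff: A (n + \sum_j w 0 j *: 'e_j) /\ g (n + \sum_j w 0 j *: 'e_j) = g n.
  by case.
elim/big_rec: _ => [|k v _ [Av gv]]; first by rewrite addr0.
have [->|wk] := eqVneq (w 0 k) 0; first by rewrite scale0r add0r.
rewrite [_ + v]addrC addrA -gv; split; first exact: wA.
exact: (@constant_on_line _ _ A g k _ _ gA (wA k wk)).
Qed.

Lemma constant_on_lattice {d : nat} {T : Type} (g : site d -> T) :
  (forall n m, adjacent n m -> g n = g m) -> forall n m, g n = g m.
Proof.
move=> gE n m; rewrite -[n](subrKC m).
by apply: (@constant_along d T setT g m) => // *; exact: gE.
Qed.

Lemma finite_set_bounded {d : nat} (F : set (site d)) : finite_set F ->
  exists B : int, forall (n : site d) k, B <= `|n 0 k| -> ~ F n.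
Proof.
move=> finF.
exists (1 + \sum_(n <- fset_set F) \sum_k `|n 0 k|) => n k Bn Fn.
have: n \in fset_set F by rewrite in_fset_set // inE.
move=> nF; move: Bn; rewrite leNgt => /negP; apply.
rewrite (big_rem n) //= (bigD1 k) //= ltz1D -!addrA lerDl.
by rewrite addr_ge0 // sumr_ge0 // => *; rewrite ?sumr_ge0.
Qed.

Lemma finite_set_outside {d : nat} (F : set (site d)) : (0 < d)%N ->
  finite_set F -> exists n, ~ F n.
Proof.
case: d F => // d F _ /finite_set_bounded [B BF].
by exists (const_mx B); apply: (BF _ ord0); rewrite mxE ler_norm.
Qed.

Lemma finite_set_box {d : nat} (B : int) :
  finite_set [set n : site d | forall k, `|n 0 k| < B].
Proof.
have [s sB] : exists s : seq int, forall z, `|z| < B -> z \in s.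
  exists ([seq i%:Z | i <- iota 0 `|B|] ++ [seq - i%:Z | i <- iota 0 `|B|]).
  move=> z zB; rewrite mem_cat; apply/orP.
  have [z0|z0] := leP 0 z; [left|right]; apply/mapP; exists `|z|%N;
    rewrite ?mem_iota; lia.
apply: (@sub_finite_set _ _
  ((fun f : {ffun 'I_d -> seq_sub s} => \row_k val (f k)) @` setT)).
  move=> n /= nB; exists [ffun k => SeqSub (sB _ (nB k))] => //.
  by apply/rowP => k; rewrite !mxE ffunE.
by apply: finite_image; exact: finite_finset.
Qed.

(** The complement of a box is connected as soon as [d >= 2]: from a site whose
    coordinate [k] is large, all the other coordinates can be moved to [B], and
    then any one of these, kept fixed, lets coordinate [k] move to [B] too. *)
Lemma constant_off_finite {d : nat} {T : Type} (F : set (site d))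
    (g : site d -> T) : (1 < d)%N -> finite_set F ->
  (forall n m, ~ F n -> ~ F m -> adjacent n m -> g n = g m) ->
  exists c, finite_set [set n | g n <> c].
Proof.
move=> d1 /[dup] finF /finite_set_bounded [B0 B0F] gF.
pose B := Num.max B0 1.
have B1 : 0 <= B by rewrite /B; lia.
have BF (n : site d) k : B <= `|n 0 k| -> ~ F n by move=> nk; apply: (B0F n k); lia.
pose A (k : 'I_d) := [set n : site d | B <= `|n 0 k|].
have gA k n m : A k n -> A k m -> adjacent n m -> g n = g m.
  by move=> /BF nF /BF mF; exact: gF.
(* moves that leave coordinate k untouched stay in A k *)
have move k (n m : site d) : A k n -> n 0 k = m 0 k -> g m = g n.
  move=> An nmk; rewrite -(subrKC n m).
  apply: (@constant_along d T (A k)) => // [|j wj v z Av]; first exact: gA.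
  have jk : k != j by apply: contraNneq wj => <-; rewrite !mxE nmk subrr.
  by rewrite /A /= !mxE (negbTE jk) mulr0 addr0.
exists (g (const_mx B)).
have box k (n : site d) : B <= `|n 0 k| -> g n = g (const_mx B).
  move=> nk.
  have [l lk] : exists l : 'I_d, l != k.
    case: d d1 k {n nk F gF B0F BF A gA move finF g} => [|[|d]] // _ k.
    have [->|] := eqVneq k ord0; first by exists ord_max.
    by rewrite eq_sym => k0; exists ord0.
  pose n' : site d := \row_j if j == k then n 0 k else B.
  transitivity (g n'); first by rewrite (@move k n n') // mxE eqxx.
  rewrite (@move l n' (const_mx B)) /A /= ?mxE ?(negbTE lk) //.
  by rewrite ler_norm.
apply: sub_finite_set (finite_set_box B) => n /= gn k.
by rewrite ltNge; apply/negP => /box.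
Qed.

(** * Height functions and their reductions *)

Lemma intr_Zp_small (r : nat) (a b : int) : (2 < r)%N ->
  a%:~R = b%:~R :> 'Z_r -> `|a - b| <= 2 -> a = b.
Proof.
move=> r2 ab ab2; apply/eqP; rewrite -subr_eq0 -absz_eq0.
have: (`|a - b|%N%:R : 'Z_r) = 0.
  have /eqP := ab; rewrite -subr_eq0 -rmorphB /= => /eqP.
  case: (a - b) => k //; rewrite NegzE rmorphN => /eqP.
  by rewrite oppr_eq0 => /eqP.
move/(congr1 val); rewrite /= val_Zp_nat ?(ltn_trans _ r2) //.
by rewrite modn_small; lia.
Qed.

(** Along an edge a height function changes by 1 or -1, and these are
    distinguished modulo [r]: the reduction determines the gradient. *)
Lemma phi_gradient {d r : nat} {x y : site d -> int} {n m : site d} :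
  (2 < r)%N -> Ht x -> Ht y ->
  phi r x n = phi r y n -> phi r x m = phi r y m -> adjacent n m ->
  x n - y n = x m - y m.
Proof.
move=> r2 hx hy xyn xym nm.
have := hx _ _ nm; have := hy _ _ nm => hy' hx'.
suff: x n - x m = y n - y m by lia.
apply: (@intr_Zp_small r) => //; last by lia.
by rewrite !rmorphB /= (xyn : (x n)%:~R = _) (xym : (x m)%:~R = _).
Qed.

Lemma Ht_parity {d : nat} {x y : site d -> int} (n m : site d) :
  Ht x -> Ht y -> ((x n - y n)%R = (x m - y m)%R %[mod 2])%Z.
Proof.
move=> hx hy; move: n m.
apply: (@constant_on_lattice d _ (fun n => ((x n - y n)%R %% 2)%Z)) => n m nm.
by have := hx _ _ nm; have := hy _ _ nm; lia.
Qed.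

Lemma Ht_even {d : nat} {x y : site d -> int} (n : site d) : (0 < d)%N ->
  Ht x -> Ht y -> finite_set [set m | x m <> y m] ->
  (x n = y n %[mod 2])%Z.
Proof.
move=> d0 hx hy /(finite_set_outside _) [//|m /= /contrapT xym].
by have := Ht_parity n m hx hy; lia.
Qed.

(** * The counting functions *)

Definition class_interval {r : nat} (i : 'Z_r) (a b : int) : set int :=
  [set m : int | [/\ (m = a %[mod 2])%Z, m%:~R = i & a <= m < b]].

Lemma finite_class_interval {r : nat} (i : 'Z_r) (a b : int) :
  finite_set (class_interval i a b).
Proof.
apply: (@sub_finite_set _ _ ((fun k : nat => a + k%:Z) @` `I_(`|b - a|))).
  by move=> m [_ _ mab]; exists `|m - a|%N => /=; lia.
by apply: finite_image; exact: finite_II.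
Qed.

Lemma card_fset_setU1_notin (T : choiceType) (a : T) (A : set T) :
  finite_set A -> ~ A a -> #|` fset_set (a |` A)| = (#|` fset_set A|).+1.
Proof.
move=> finA Aa; rewrite fset_setU1 // cardfsU1 in_fset_set //.
by rewrite (memNset Aa).
Qed.

Lemma N_up0 {r : nat} (i : 'Z_r) (a b : int) : b <= a -> N_up i a b = 0%N.
Proof.
move=> ba; rewrite /N_up -/(class_interval i a b).
rewrite (_ : class_interval i a b = set0) ?fset_set0 //.
by apply/seteqP; split => // m [_ _]; lia.
Qed.

Lemma N_up_recr {r : nat} (i : 'Z_r) (a b : int) :
  (a = b %[mod 2])%Z -> a <= b ->
  N_up i a (b + 2) = (N_up i a b + (b%:~R == i))%N.
Proof.
move=> ab leab; rewrite /N_up -!/(class_interval _ _ _).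
have [bi|bi] := eqVneq b%:~R i.
  rewrite addn1 -(@card_fset_setU1_notin _ b); first last.
  - by move=> [_ _]; lia.
  - exact: finite_class_interval.
  congr (#|` fset_set _|); apply/seteqP; split => m /=.
    have [->|mb] := eqVneq m b; first by left.
    by move=> [? ? ?]; right; split => //; lia.
  by case=> [->|[? ? ?]]; split => //; lia.
rewrite addn0; congr (#|` fset_set _|); apply/seteqP; split => m /= [? mi ?].
  have mb : m <> b by move=> mb; rewrite -mb mi eqxx in bi.
  by split => //; lia.
by split => //; lia.
Qed.

Lemma N_up_recl {r : nat} (i : 'Z_r) (a b : int) :
  a < b -> N_up i a b = (N_up i (a + 2) b + (a%:~R == i))%N.
Proof.
move=> leab; rewrite /N_up -!/(class_interval _ _ _).
have [ai|ai] := eqVneq a%:~R i.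
  rewrite addn1 -(@card_fset_setU1_notin _ a); first last.
  - by move=> [_ _]; lia.
  - exact: finite_class_interval.
  congr (#|` fset_set _|); apply/seteqP; split => m /=.
    have [->|ma] := eqVneq m a; first by left.
    by move=> [? ? ?]; right; split => //; lia.
  by case=> [->|[? ? ?]]; split => //; lia.
rewrite addn0; congr (#|` fset_set _|); apply/seteqP; split => m /= [? mi ?].
  have ma : m <> a by move=> ma; rewrite -ma mi eqxx in ai.
  by split => //; lia.
by split => //; lia.
Qed.

Lemma Nxx {r : nat} (i : 'Z_r) (a : int) : N i a a = 0.
Proof. by rewrite /N lexx N_up0. Qed.

(** With [Nxx], this recursion characterises the signed count, so that the
    algebraic properties below follow by induction on the second argument. *)
Lemma N_step {r : nat} (i : 'Z_r) (a b : int) : (a = b %[mod 2])%Z ->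
  N i a (b + 2) = N i a b + (b%:~R == i)%:Z.
Proof.
move=> ab; rewrite /N; case: (leP a b) => ab1.
  by rewrite ifT ?N_up_recr //; lia.
rewrite (@N_up_recl _ i b a) //.
have [ab2|ab2] := leP a (b + 2); last by lia.
have -> : b + 2 = a by lia.
by rewrite !N_up0 //; lia.
Qed.

Lemma even_int_ind (a : int) (P : int -> Prop) : P a ->
  (forall b, (a = b %[mod 2])%Z -> P b <-> P (b + 2)) ->
  forall b, (a = b %[mod 2])%Z -> P b.
Proof.
move=> Pa Pstep b ab; have -> : b = a + 2 * ((b - a) %/ 2)%Z by lia.
elim: ((b - a) %/ 2)%Z => [|k|k]; first by rewrite mulr0 addr0.
  move=> Pk; have -> : a + 2 * k.+1%:Z = a + 2 * k%:Z + 2 by lia.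
  by apply: (iffLR (Pstep _ _)) => //; lia.
move=> Pk; apply: (iffRL (Pstep _ _)); first by lia.
by have -> : a + 2 * - k.+1%:Z + 2 = a + 2 * - k%:Z by lia.
Qed.

Lemma N_add {r : nat} (i : 'Z_r) (a b c : int) :
  (a = b %[mod 2])%Z -> (b = c %[mod 2])%Z -> N i a b + N i b c = N i a c.
Proof.
move=> ab; move: c; apply: even_int_ind => [|c bc]; first by rewrite Nxx addr0.
by rewrite !N_step //; [lia | lia].
Qed.

Lemma N_translate {r : nat} (i : 'Z_r) (a b c : int) :
  (a = b %[mod 2])%Z -> c%:~R = 0 :> 'Z_r -> N i (a + c) (b + c) = N i a b.
Proof.
move=> ab c0; move: b ab; apply: even_int_ind => [|b ab]; first by rewrite !Nxx.
rewrite addrAC !N_step //; last by lia.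
by rewrite rmorphD /= c0 addr0; split=> [->|/addIr].
Qed.

(** A full period is counted the same way wherever it starts, within a parity
    class: moving the start by 2 drops one element and adds its translate. *)
Lemma N_period {r : nat} (i : 'Z_r) (a b c : int) :
  (a = b %[mod 2])%Z -> (c = 0 %[mod 2])%Z -> c%:~R = 0 :> 'Z_r ->
  N i a (a + c) = N i b (b + c).
Proof.
move=> ab c2 c0; apply: esym; move: b ab; apply: even_int_ind => // b ab.
have : N i b (b + 2) + N i (b + 2) (b + 2 + c) = N i b (b + c + 2).
  by rewrite [in RHS]addrAC; apply: N_add; lia.
rewrite !(@N_step _ i b) ?Nxx ?add0r //; last by lia.
by rewrite rmorphD /= c0 addr0 addrC => /addIr ->.
Qed.

(** * Lifts *)

Definition Delta_pair {d : nat} {A : Type} {X : set (site d -> A)}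
    {x y : site d -> A} (hx : X x) (hy : X y)
    (xy : finite_set [set n | x n <> y n]) : Delta X :=
  exist _ (x, y) (mem_set (And3 hx hy xy)).

Lemma finite_diff_phi {d : nat} (r : nat) (x y : site d -> int) :
  finite_set [set n | x n <> y n] ->
  finite_set [set n | phi r x n <> phi r y n].
Proof.
by apply: sub_finite_set => n /= xy e; apply: xy; rewrite /phi e.
Qed.

Lemma Ht_addr {d : nat} {x : site d -> int} (c : int) :
  Ht x -> Ht (fun n => x n + c).
Proof. by move=> hx n m /hx; rewrite opprD addrACA subrr addr0. Qed.

Lemma phi_addr {d r : nat} (x : site d -> int) (c : int) :
  c%:~R = 0 :> 'Z_r -> phi r (fun n => x n + c) = phi r x.
Proof. by move=> c0; apply/funext => n; rewrite /phi rmorphD /= c0 addr0. Qed.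

Lemma lift_exists {d r : nat} (p : Delta (@X d r)) : (1 < d)%N -> (2 < r)%N ->
  exists q, is_lift p q.
Proof.
move=> d1 r2; have [[x hx ex] [y hy ey] fin] := set_valP p.
have xyE n : (val p).1 n = (val p).2 n -> phi r x n = phi r y n.
  by rewrite ex ey.
have [c finc] : exists c, finite_set [set n | x n - y n <> c].
  apply: (@constant_off_finite _ _ _ _ d1 fin) => n m.
  move=> /contrapT/xyE xyn /contrapT/xyE xym.
  exact: (@phi_gradient d r).
have c0 : c%:~R = 0 :> 'Z_r.
  have [||n] := @finite_set_outside _
    ([set n | (val p).1 n <> (val p).2 n] `|` [set n | x n - y n <> c]).
  - exact: ltnW.
  - by rewrite finite_setU.
  move/not_orP => [/contrapT/xyE xyn /contrapT <-].
  by rewrite rmorphB /= (xyn : (x n)%:~R = (y n)%:~R) subrr.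
have fin' : finite_set [set n | x n <> y n + c].
  by apply: sub_finite_set finc => n /=; lia.
exists (Delta_pair hx (Ht_addr c hy) fin').
by split => //=; rewrite phi_addr.
Qed.

Lemma lift_unique {d r : nat} (x y : site d -> int) : (2 < r)%N ->
  Ht x -> Ht y -> phi r x = phi r y ->
  exists2 c, c%:~R = 0 :> 'Z_r & forall n, y n = x n + c.
Proof.
move=> r2 hx hy xy; exists (y 0 - x 0).
  have := congr1 (@^~ 0) xy; rewrite /phi rmorphB /= => <-.
  by rewrite subrr.
move=> n; rewrite (_ : y 0 - x 0 = y n - x n); first by lia.
move: 0 n; apply: (@constant_on_lattice d _ (fun n => y n - x n)) => n m.
by apply: (@phi_gradient d r); rewrite // xy.
Qed.

Lemma Delta_Ht_even {d : nat} (q : Delta (@Ht d)) (n : site d) : (0 < d)%N ->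
  ((val q).1 n = (val q).2 n %[mod 2])%Z.
Proof. by move=> d0; have [hx hy fin] := set_valP q; apply: Ht_even. Qed.

Lemma lift_sum_unique (R : realType) {d r : nat} (i : 'Z_r)
    (p : Delta (@X d r)) (q q' : Delta (@Ht d)) : (0 < d)%N -> (2 < r)%N ->
  is_lift p q -> is_lift p q' -> lift_sum R i q = lift_sum R i q'.
Proof.
move=> d0 r2 [q1 q2] [q'1 q'2].
have [hx hy fin] := set_valP q; have [hx' hy' fin'] := set_valP q'.
have [c c0 xx'] := @lift_unique _ _ _ _ r2 hx hx' (etrans q1 (esym q'1)).
have [c' _ yy'] := @lift_unique _ _ _ _ r2 hy hy' (etrans q2 (esym q'2)).
have cc' : c' = c.
  have [//||n] := @finite_set_outside _
    ([set n | (val q).1 n <> (val q).2 n] `|`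
     [set n | (val q').1 n <> (val q').2 n]).
    by rewrite finite_setU.
  move/not_orP => [/contrapT xyn /contrapT].
  by rewrite xx' yy' xyn => /addrI.
apply: eq_fsbigr => n _; congr (_%:~R).
rewrite xx' yy' cc' N_translate //; exact: Delta_Ht_even.
Qed.

Lemma MiE (R : realType) {d r : nat} (i : 'Z_r)
    {p : Delta (@X d r)} {q : Delta (@Ht d)} : (0 < d)%N -> (2 < r)%N ->
  is_lift p q -> @Mi R d r i p = lift_sum R i q.
Proof.
move=> d0 r2 pq; rewrite /Mi; case: xgetP => [v _ [q' pq' ->]|/(_ (lift_sum R i q))].
  exact: (@lift_sum_unique R _ _ i p).
by case; exists q.
Qed.

(** * The functions M_i are shift-invariant Markov cocycles *)

Lemma lift_sum_finite (R : realType) {d r : nat} (i : 'Z_r)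
    (q : Delta (@Ht d)) (D : set (site d)) :
  (forall n, ~ D n -> (val q).1 n = (val q).2 n) ->
  lift_sum R i q =
    \sum_(n \in D) ((N i ((val q).1 n) ((val q).2 n))%:~R : R).
Proof.
by move=> qD; apply/esym/fsbig_widen => // n [_ /qD] /= ->; rewrite Nxx.
Qed.

(** By uniqueness up to multiples of [r], a lift of [(y, z)] can be translated
    so as to continue a lift of [(x, y)]; then the counts add up sitewise. *)
Lemma Mi_cocycle (R : realType) {d r : nat} (i : 'Z_r) :
  (1 < d)%N -> (2 < r)%N -> cocycle (@Mi R d r i).
Proof.
move=> d1 r2 p q s pq sE; have d0 := ltnW d1.
have [P lP] := lift_exists p d1 r2.
have [Q lQ] := lift_exists q d1 r2.
have [hx hy xy] := set_valP P; have [hy' hz yz] := set_valP Q.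
have [c c0 yy'] : exists2 c, c%:~R = 0 :> 'Z_r &
    forall n, (val P).2 n = (val Q).1 n + c.
  by apply: lift_unique; rewrite // lP.2 lQ.1 pq.
have xz : finite_set [set n | (val P).1 n <> (val Q).2 n + c].
  move: (conj xy yz); rewrite -finite_setU; apply: sub_finite_set => n /= xz.
  by apply/not_andP => -[xy' yz']; apply: xz; rewrite xy' yy' yz'.
pose S := Delta_pair hx (Ht_addr c hz) xz.
have lS : is_lift s S by rewrite /is_lift sE /= phi_addr // lP.1 lQ.2.
rewrite (MiE _ _ d0 r2 lP) (MiE _ _ d0 r2 lQ) (MiE _ _ d0 r2 lS).
(* a common finite index set, so that the sums can be added *)
pose D := [set n | (val P).1 n <> (val P).2 n] `|`
          [set n | (val Q).1 n <> (val Q).2 n].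
have D12 n : ~ D n -> (val P).1 n = (val P).2 n /\ (val Q).1 n = (val Q).2 n.
  by move=> /not_orP [/contrapT ? /contrapT ?].
rewrite !(@lift_sum_finite R _ _ i _ D); first last.
- by move=> n /D12 [/= -> <-].
- by move=> n /D12 [].
- by move=> n /D12 [].
rewrite -fsbig_split ?finite_setU //.
apply: eq_fsbigr => n _ /=; rewrite -intrD; congr (_%:~R).
rewrite -(@N_translate _ i _ ((val Q).2 n) c) //; last exact: Delta_Ht_even.
rewrite -yy' N_add //; first exact: Delta_Ht_even.
by rewrite yy'; have := Delta_Ht_even Q n d0; lia.
Qed.

Lemma Mi_shift_invariant (R : realType) {d r : nat} (i : 'Z_r) :
  (1 < d)%N -> (2 < r)%N -> shift_invariant (@Mi R d r i).
Proof.
move=> d1 r2 v p q qE; have d0 := ltnW d1.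
have [P lP] := lift_exists p d1 r2; have [hx hy xy] := set_valP P.
have hs x : Ht x -> Ht (shift v x).
  by move=> hx' n m nm; apply: hx'; exact: adjacentDr.
have bv : bijective (+%R^~ v : site d -> site d).
  by exists (+%R^~ (- v)) => n; rewrite ?addrK ?subrK.
have sxy : finite_set
    [set n | shift v (val P).1 n <> shift v (val P).2 n].
  have := finite_image (fun n => n - v) xy; apply: sub_finite_set => n /= xyn.
  by exists (n + v); rewrite ?addrK.
pose Q := Delta_pair (hs _ hx) (hs _ hy) sxy.
have lQ : is_lift q Q by rewrite /is_lift qE /= -lP.1 -lP.2.
rewrite (MiE _ _ d0 r2 lP) (MiE _ _ d0 r2 lQ) /lift_sum.
by rewrite [RHS](@reindex_fsbigT _ _ _ _ _ (+%R^~ v)).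
Qed.

(** For a lift [(x, y)] of a pair that agrees off [F], put [D = x - y]. The
    increment of [D] along an edge is determined by the pair on the closure of
    [F] if an endpoint lies in [F], and vanishes otherwise; as [D] is zero near
    infinity, the pair on the closure of [F] determines [D] everywhere. Off that
    closure, [D] need not vanish (it is a multiple of [r] on the holes that [F]
    encloses); there the summands are full periods, which [N_period] compares.
    This needs heights of equal parity, arranged with the help of a site of [F],
    where the heights in the two lifts differ by a multiple of [r]. *)
Lemma Mi_markov (R : realType) {d r : nat} (i : 'Z_r) :
  (1 < d)%N -> (2 < r)%N -> markov (@Mi R d r i).
Proof.
move=> d1 r2 F finF p q pF qF pq1 pq2; have d0 := ltnW d1.
have [P lP] := lift_exists p d1 r2; have [hx hy xy] := set_valP P.
have [Q lQ] := lift_exists q d1 r2; have [hx' hy' xy'] := set_valP Q.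
rewrite (MiE _ _ d0 r2 lP) (MiE _ _ d0 r2 lQ) /lift_sum.
have [P1 P2] := lP; have [Q1 Q2] := lQ; move: (Delta_Ht_even P) (Delta_Ht_even Q).
rewrite -{}P1 -{}P2 -{}Q1 -{}Q2 in pF qF pq1 pq2.
move: (val P).1 (val P).2 (val Q).1 (val Q).2 =>
  x y x' y' in hx hy xy hx' hy' xy' pF qF pq1 pq2 * => ev ev'.
pose F' := F `|` boundary F.
have FF' n m : adjacent n m -> F n -> F' n /\ F' m.
  move=> nm Fn; split; first by left.
  have [Fm|Fm] := pselect (F m); [by left|right; split=> //].
  by exists n => //; exact: adjacentC.
have DE n : x n - y n = x' n - y' n.
  have [|m /=] := @finite_set_outside _
      ([set n | x n <> y n] `|` [set n | x' n <> y' n]) d0.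
    by rewrite finite_setU.
  move/not_orP => [/contrapT xym /contrapT xym'].
  (* both differences vanish at m, so it suffices that their gradients agree *)
  suff : x n - y n - (x' n - y' n) = x m - y m - (x' m - y' m) by lia.
  move: n m {xym xym'}; apply: (@constant_on_lattice d _
    (fun n => x n - y n - (x' n - y' n))).
  have inE' n m : adjacent n m -> F' n /\ F' m ->
      x n - y n - (x' n - y' n) = x m - y m - (x' m - y' m).
    move=> nm [/mem_set Fn /mem_set Fm].
    have := phi_gradient r2 hx hx' (pq1 _ Fn) (pq1 _ Fm) nm.
    have := phi_gradient r2 hy hy' (pq2 _ Fn) (pq2 _ Fm) nm.
    by lia.
  move=> n m nm; have [Fn|Fn] := pselect (F n); first exact/inE'/FF'.
  have [Fm|Fm] := pselect (F m).
    by apply/esym/inE'; [|apply: FF' => //]; exact: adjacentC.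
  have nF := mem_set (Fn : (~` F) n); have mF := mem_set (Fm : (~` F) m).
  have := phi_gradient r2 hx hy (pF _ nF) (pF _ mF) nm.
  have := phi_gradient r2 hx' hy' (qF _ nF) (qF _ mF) nm.
  by lia.
apply: eq_fsbigr => n _; congr (_%:~R).
have [Fn|Fn] := pselect (F' n).
  have := pq1 _ (mem_set Fn); rewrite /phi => xx'.
  have -> : x n = x' n + (x n - x' n) by lia.
  have -> : y n = y' n + (x n - x' n) by have := DE n; lia.
  by rewrite N_translate // ?rmorphB /= ?xx' ?subrr //; exact: ev'.
have nF : n \in ~` F by apply/mem_set => Fn'; apply: Fn; left.
have -> : y n = x n + (y n - x n) by lia.
have -> : y' n = x' n + (y n - x n) by have := DE n; lia.
have [[m Fm]|F0] := pselect (exists m, F m); last first.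
  have Fn' k : k \in ~` F by apply/mem_set => Fk; apply: F0; exists k.
  have [|c _ yx] := @lift_unique d r _ _ r2 hx hy.
    by apply/funext => k; exact: pF.
  have [k /contrapT xyk] := finite_set_outside _ d0 xy.
  have -> : y n - x n = 0 by have := yx k; have := yx n; lia.
  by rewrite !addr0 !Nxx.
have := pq1 _ (mem_set (or_introl Fm : F' m)); rewrite /phi => xx'.
(* translating the heights x by this multiple of r gives them the parity of x' *)
have e0 : (x' m - x m)%:~R = 0 :> 'Z_r by rewrite rmorphB /= xx' subrr.
have D0 : (y n - x n)%:~R = 0 :> 'Z_r.
  by rewrite rmorphB /= (esym (pF _ nF) : (y n)%:~R = (x n)%:~R) subrr.
have D2 := ev n d0.
rewrite -(@N_translate _ i _ _ _ _ e0); last by lia.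
rewrite addrAC; apply: N_period => //; last by lia.
by have := Ht_parity n m hx hx'; lia.
Qed.

(** * Single-site flips *)

Definition flip {d : nat} (x : site d -> int) (n : site d) : site d -> int :=
  fun m => if m == n then x m + 2 else x m.

Definition local_min {d : nat} (x : site d -> int) (n : site d) : Prop :=
  forall m, adjacent m n -> x m = x n + 1.

Lemma Ht_flip {d : nat} {x : site d -> int} {n : site d} :
  Ht x -> local_min x n -> Ht (flip x n).
Proof.
move=> hx xn m k mk; rewrite /flip; have := hx _ _ mk.
have [mn|mn] := eqVneq m n; have [kn|kn] := eqVneq k n => //.
- by have := adjacent_neq _ _ mk; rewrite mn kn.
- by rewrite mn in mk *; have := xn _ (adjacentC _ _ mk); lia.
- by rewrite kn in mk *; have := xn _ mk; lia.
Qed.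

Lemma flip_diff {d : nat} (x : site d -> int) (n : site d) :
  finite_set [set m | x m <> flip x n m].
Proof.
apply: (@sub_finite_set _ _ [set n]) => // m /=; rewrite /flip.
by case: (eqVneq m n).
Qed.

Lemma X_phi {d : nat} (r : nat) {x : site d -> int} :
  Ht x -> @X d r (phi r x).
Proof. by exists x. Qed.

(** The flattest height function: the values [a] and [a + 1] on the two
    parity classes of sites. *)
Definition base {d : nat} (a : int) : site d -> int :=
  fun n => a + ((\sum_k n 0 k)%R %% 2)%Z.

Lemma sum_adjacent {d : nat} (n m : site d) : adjacent n m ->
  ((\sum_k n 0 k)%R = (\sum_k m 0 k)%R + 1 %[mod 2])%Z.
Proof.
rewrite /adjacent => nm.
suff: ((\sum_k n 0 k - \sum_k m 0 k)%R = \sum_k `|n 0 k - m 0 k|%R %[mod 2])%Z.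
  by rewrite nm; lia.
rewrite -sumrB; elim/big_rec2: _ => // k u v _.
by lia.
Qed.

Lemma base_local_min {d : nat} (a : int) : local_min (@base d a) 0.
Proof.
move=> m /sum_adjacent; rewrite /base.
have -> : \sum_k (0 : site d) 0 k = 0 by rewrite big1 // => k _; rewrite mxE.
by lia.
Qed.

Lemma base0 {d : nat} (a : int) : @base d a 0 = a.
Proof. by rewrite /base big1 ?addr0 // => k _; rewrite mxE. Qed.

Lemma Ht_base {d : nat} (a : int) : Ht (@base d a).
Proof. by move=> n m /sum_adjacent; rewrite /base; lia. Qed.

Definition bump_lift {d r : nat} (i : 'Z_r) : Delta (@Ht d) :=
  Delta_pair (Ht_base i) (Ht_flip (Ht_base i) (base_local_min i))
    (flip_diff (base i) 0).

Definition bump {d r : nat} (i : 'Z_r) : Delta (@X d r) :=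
  Delta_pair (X_phi r (Ht_base i))
    (X_phi r (Ht_flip (Ht_base i) (base_local_min i)))
    (finite_diff_phi r (base i) _ (flip_diff (base i) 0)).

Lemma Mi_bump (R : realType) {d r : nat} (i j : 'Z_r) :
  (0 < d)%N -> (2 < r)%N -> @Mi R d r i (bump j) = (j == i)%:R.
Proof.
move=> d0 r2; rewrite (@MiE _ _ _ _ _ (bump_lift j)) //.
rewrite (@lift_sum_finite R _ _ i _ [set 0]) => [|n /= /eqP n0]; last first.
  by rewrite /flip (negbTE n0).
rewrite fsbig_set1 /= /flip eqxx base0 N_step // Nxx add0r.
by rewrite [j%:~R]natr_Zp; case: eqP.
Qed.

(** Near its flipped site a flip of [x] at a local minimum looks, modulo [r],
    like a translate of the bump of height [x n]. *)
Lemma flip_value {R : realType} {d r : nat} {M : Delta_fun R (@X d r)}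
    {x : site d -> int} {n : site d} (p : Delta (@X d r)) :
  markov M -> shift_invariant M -> local_min x n ->
  val p = (phi r x, phi r (flip x n)) -> M p = M (bump (x n)%:~R).
Proof.
move=> mM sM xn pE; set i := (x n)%:~R : 'Z_r.
have hs y : Ht y -> Ht (shift (- n) y : site d -> int).
  by move=> hy k m km; apply: hy; exact: adjacentDr.
pose b := @base d i; have bmin : local_min b 0 := base_local_min i.
have hb : Ht b := Ht_base i; have hfb : Ht (flip b 0) := Ht_flip hb bmin.
have fin : finite_set
    [set m | phi r (shift (- n) b) m <> phi r (shift (- n) (flip b 0)) m].
  apply/finite_diff_phi/(@sub_finite_set _ _ [set n]) => // m /=.
  rewrite /shift /flip subr_eq0.
  by case: (eqVneq m n).
pose q : Delta (@X d r) := Delta_pair (X_phi r (hs _ hb)) (X_phi r (hs _ hfb)) fin.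
rewrite -(sM (- n) (bump i) q) //.
have ix : (b 0)%:~R = (x n)%:~R :> 'Z_r by rewrite /b base0 [_%:~R]natr_Zp.
have addr_congr (u v c : int) : u%:~R = v%:~R :> 'Z_r ->
    (u + c)%:~R = (v + c)%:~R :> 'Z_r by rewrite !rmorphD /= => ->.
have xb : {in [set n] `|` boundary [set n], phi r x =1 phi r (shift (- n) b)}.
  move=> m /set_mem mn; rewrite /phi /shift.
  case: mn => [->|[_ [k -> mn]]]; first by rewrite subrr ix.
  have -> : b (m - n) = b 0 + 1.
    by apply: bmin; rewrite -(subrr n); exact: adjacentDr.
  by rewrite (xn m mn); apply: addr_congr; rewrite ix.
apply: (mM [set n]) => //=.
- by move=> m /set_mem /= /eqP mn; rewrite pE /= /phi /flip (negbTE mn).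
- move=> m /set_mem /= /eqP mn; rewrite /phi /shift /flip.
  by rewrite subr_eq0 (negbTE mn).
- by rewrite pE.
rewrite pE /= => m /xb; rewrite /phi /shift /flip subr_eq0.
by case: ifP => // _; exact: addr_congr.
Qed.

(** A site where [x] is lowest among those with [x < y] is a local minimum of
    [x]: a lower neighbour would also satisfy [x < y], since [y] only drops by
    1 whereas, by parity, [y >= x + 2] at the site. *)
Lemma local_min_below {d : nat} (D : {fset site d}) (x y : site d -> int) :
  Ht x -> Ht y -> (forall n, (x n = y n %[mod 2])%Z) ->
  (forall n, n \notin D -> x n = y n) -> (exists n, x n < y n) ->
  exists n, [/\ n \in D, local_min x n & x n + 2 <= y n].
Proof.
move=> hx hy xy xyD [n0 xyn0].
have n0D : n0 \in D by apply: contraLR xyn0 => /xyD ->; rewrite ltxx.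
case: (@Order.TotalTheory.arg_minP _ _ D (FSetSub n0D)
  (fun n => x (val n) < y (val n)) (fun n => x (val n))) => //.
move=> [n nD] /= xyn min_n; exists n; split => //; last by have := xy n; lia.
move=> m mn; have := hx _ _ mn; have := hy _ _ mn.
have [xym|] := ltP (x m) (y m); last by have := xy n; lia.
have mD : m \in D by apply: contraLR xym => /xyD ->; rewrite ltxx.
by have := min_n (FSetSub mD) xym; rewrite /=; lia.
Qed.

Lemma flip_closer {d : nat} (D : {fset site d}) (x y : site d -> int)
    (n : site d) : n \in D -> x n + 2 <= y n ->
  (\sum_(m <- D) `|flip x n m - y m| < \sum_(m <- D) `|x m - y m|)%N.
Proof.
move=> nD xyn; rewrite !(big_rem n nD) /= -addSn; apply: leq_add.
  by rewrite /flip eqxx; lia.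
by apply: leq_sum => m _; rewrite /flip; case: (eqVneq m n) => [->|_] //; lia.
Qed.

Lemma flip_supp {d : nat} {D : {fset site d}} {x y : site d -> int}
    {n : site d} : n \in D ->
  (forall m, m \notin D -> x m = y m) ->
  forall m, m \notin D -> flip x n m = y m.
Proof.
move=> nD xyD m mD; rewrite /flip ifN ?xyD //.
by apply: contraNneq mD => ->.
Qed.

Lemma finite_diff_fset {d : nat} {D : {fset site d}} {x y : site d -> int} :
  (forall m, m \notin D -> x m = y m) -> finite_set [set m | x m <> y m].
Proof.
move=> xyD; apply: (@sub_finite_set _ _ [set` D]) => // m /= xym.
by apply: contrapT => /negP /xyD.
Qed.

(** Induction on the area between two height functions: raising a local
    minimum of the lower one shrinks it. *)
Lemma cocycle_eq0_of_flips {R : realType} {d r : nat}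
    {M : Delta_fun R (@X d r)} (D : {fset site d}) : cocycle M ->
  (forall (x : site d -> int) n p, Ht x -> local_min x n ->
    val p = (phi r x, phi r (flip x n)) -> M p = 0) ->
  forall x y p, Ht x -> Ht y -> (forall n, (x n = y n %[mod 2])%Z) ->
    (forall n, n \notin D -> x n = y n) ->
    val p = (phi r x, phi r y) -> M p = 0.
Proof.
move=> cM M0 x y.
have [k] := ubnP (\sum_(n <- D) `|x n - y n|)%N; elim: k x y => // k IH x y.
rewrite ltnS => xyk p hx hy xy xyD pE.
have xpar n m : (x n = flip x m n %[mod 2])%Z.
  by rewrite /flip; case: ifP => _; lia.
have ypar n m : (y n = flip y m n %[mod 2])%Z.
  by rewrite /flip; case: ifP => _; lia.
have [xlty|xgey] := pselect (exists n, x n < y n).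
  have [n [nD xn xyn]] := local_min_below D _ _ hx hy xy xyD xlty.
  have hx' := Ht_flip hx xn; have x'yD := flip_supp nD xyD.
  pose s : Delta (@X d r) := Delta_pair (X_phi r hx) (X_phi r hx')
    (finite_diff_phi r _ _ (flip_diff x n)).
  pose p' : Delta (@X d r) := Delta_pair (X_phi r hx') (X_phi r hy)
    (finite_diff_phi r _ _ (finite_diff_fset x'yD)).
  rewrite (cM s p' p) // (M0 x n s) // add0r.
  apply: (IH (flip x n) y) => // [|m]; last by rewrite -xpar.
  exact: leq_trans (flip_closer _ _ _ _ nD xyn) xyk.
have yxD n (nD : n \notin D) : y n = x n by rewrite xyD.
have yx n : (y n = x n %[mod 2])%Z by rewrite xy.
have [yltx|ygex] := pselect (exists n, y n < x n).
  have [n [nD yn yxn]] := local_min_below D _ _ hy hx yx yxD yltx.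
  have hy' := Ht_flip hy yn; have y'xD := flip_supp nD yxD.
  have xy'D m (mD : m \notin D) : x m = flip y n m by rewrite y'xD.
  pose s : Delta (@X d r) := Delta_pair (X_phi r hy) (X_phi r hy')
    (finite_diff_phi r _ _ (flip_diff y n)).
  pose p' : Delta (@X d r) := Delta_pair (X_phi r hx) (X_phi r hy')
    (finite_diff_phi r _ _ (finite_diff_fset xy'D)).
  have -> : M p = M p'.
    by rewrite (cM p s p') ?pE // (M0 y n s) // addr0.
  apply: (IH x (flip y n)) => // [|m]; last by rewrite -ypar.
  apply: leq_trans xyk; under eq_bigr do rewrite distnC.
  under [X in (_ < X)%N]eq_bigr do rewrite distnC.
  exact: flip_closer nD yxn.
have exy : x = y.
  apply/funext => n; apply/eqP; rewrite eq_le !leNgt; apply/andP; split;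
    apply/negP => lt_n; [apply: ygex|apply: xgey]; by exists n.
have := cM p p p; rewrite pE exy => /(_ erefl erefl)/eqP.
by rewrite addrC -subr_eq subrr eq_sym => /eqP.
Qed.

Lemma cocycle_eq0_of_bumps {R : realType} {d r : nat}
    {M : Delta_fun R (@X d r)} : (1 < d)%N -> (2 < r)%N ->
  shift_invariant_markov_cocycles M -> (forall i, M (bump i) = 0) -> M = 0.
Proof.
move=> d1 r2 [cM mM sM] M0; apply/funext => p; have d0 := ltnW d1.
have [q [q1 q2]] := lift_exists p d1 r2; have [hx hy fin] := set_valP q.
apply: (@cocycle_eq0_of_flips _ _ _ _
  (fset_set [set n | (val q).1 n <> (val q).2 n]) cM _ (val q).1 (val q).2) => //.
- by move=> x n s hx' xn sE; rewrite (flip_value s mM sM xn sE).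
- by move=> n; exact: Delta_Ht_even.
- move=> n; rewrite in_fset_set // => /negP nD.
  by apply: contrapT => e; apply/nD/mem_set.
- by rewrite q1 q2; case: (val p).
Qed.

(** * The basis *)

Lemma shift_invariant_markov_cocycles0 {R : realType} {d : nat} {A : Type}
    {X : set (site d -> A)} : @shift_invariant_markov_cocycles R d A X 0.
Proof. by split => // p q s _ _; rewrite /= addr0. Qed.

Lemma shift_invariant_markov_cocyclesZD {R : realType} {d : nat} {A : Type}
    {X : set (site d -> A)} (a : R) (u v : Delta_fun R X) :
  shift_invariant_markov_cocycles u -> shift_invariant_markov_cocycles v ->
  shift_invariant_markov_cocycles (a *: u + v).
Proof.
move=> [cu mu su] [cv mv sv].
have E p : (a *: u + v) p = a * u p + v p by [].
split => [p q s pq sE|F finF p q pF qF pq1 pq2|n p q qE]; rewrite !E.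
- by rewrite (cu p q s) // (cv p q s) // mulrDr addrACA.
- by rewrite (mu F finF p q) // (mv F finF p q).
- by rewrite (su n p q) // (sv n p q).
Qed.

Lemma shift_invariant_markov_cocycles_Mi (R : realType) {d r : nat}
    (i : 'Z_r) : (1 < d)%N -> (2 < r)%N ->
  shift_invariant_markov_cocycles (@Mi R d r i).
Proof.
move=> d1 r2; split; first exact: Mi_cocycle.
  exact: Mi_markov.
exact: Mi_shift_invariant.
Qed.

Lemma shift_invariant_markov_cocycles_sum (R : realType) {d r : nat}
    (c : 'Z_r -> R) : (1 < d)%N -> (2 < r)%N ->
  shift_invariant_markov_cocycles (\sum_i c i *: @Mi R d r i).
Proof.
move=> d1 r2; elim/big_rec: _ => [|i M _ SM].
  exact: shift_invariant_markov_cocycles0.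
apply: shift_invariant_markov_cocyclesZD => //.
exact: shift_invariant_markov_cocycles_Mi.
Qed.

Lemma sum_Mi_bump (R : realType) {d r : nat} (c : 'Z_r -> R) (j : 'Z_r) :
  (0 < d)%N -> (2 < r)%N -> (\sum_i c i *: @Mi R d r i) (bump j) = c j.
Proof.
move=> d0 r2; rewrite fct_sumE (bigD1 j) //= big1 ?addr0 => [|i ij].
  transitivity (c j * @Mi R d r j (bump j)) => //.
  by rewrite Mi_bump // eqxx mulr1.
transitivity (c i * @Mi R d r i (bump j)) => //.
by rewrite Mi_bump // eq_sym (negbTE ij) mulr0.
Qed.

(** The bumps are dual to the [M_i]: evaluation at the bumps gives linear
    independence and, subtracting off, the coordinates of any cocycle. *)
Lemma Mi_basis (R : realType) {d r : nat} : (1 < d)%N -> (2 < r)%N ->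
  is_basis (@shift_invariant_markov_cocycles R d 'Z_r (@X d r))
           (fun i : 'Z_r => @Mi R d r i).
Proof.
move=> d1 r2; have d0 := ltnW d1; split=> [M|c c0 j]; last first.
  by rewrite -(sum_Mi_bump R c j d0 r2) c0.
split=> [SM|[c ->]]; last exact: shift_invariant_markov_cocycles_sum.
exists (fun i => M (bump i)); set M' := \sum_i _.
suff : (-1) *: M' + M = 0 by rewrite scaleN1r addrC => /subr0_eq.
apply: cocycle_eq0_of_bumps => // [|i].
  apply: shift_invariant_markov_cocyclesZD => //.
  exact: shift_invariant_markov_cocycles_sum.
transitivity (-1 * M' (bump i) + M (bump i)) => //.
by rewrite /M' sum_Mi_bump // mulN1r addNr.
Qed.

Theorem proposition5p2 (R : realType) (d r : nat) (hd : (2 <= d)%N)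
    (hr0 : (0 < r)%N) (hr : r \notin [:: 1; 2; 4]%N) :
  [/\ forall p : Delta (@X d r),
        (exists q, is_lift p q) /\
        (forall q, is_lift p q ->
           forall i : 'Z_r, @Mi R d r i p = lift_sum R i q),
      is_basis (@shift_invariant_markov_cocycles R d 'Z_r (@X d r))
               (fun i : 'Z_r => @Mi R d r i)
    & has_dim (@shift_invariant_markov_cocycles R d 'Z_r (@X d r)) r].
Proof.
have r2 : (2 < r)%N by case: r hr0 hr => [|[|[|[|[|r]]]]].
split.
- move=> p; split=> [|q pq i]; first exact: lift_exists.
  by apply: MiE; first exact: ltnW.
- exact: Mi_basis.
(* the index type 'Z_r reduces to 'I_r once r is of the form r'.+2 *)
- case: r r2 {hr0 hr} => [|[|r]] // r2.
  by exists (fun i : 'Z_r.+2 => @Mi R d r.+2 i); exact: Mi_basis.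
Qed.
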